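(* Let $\mathcal{C}=(C,Q,\mathcal{T})$ be a counter system with initial states $c_0\in C$, $Q_0\subseteq Q$, let $\mathcal{C}_\alpha$ be its $01$-counter system, and suppose that $\mathcal{C}$ is fully $\preceq_0$-compatible. Then there exists a run $(c_0,\mathbf{v}_0)\to(c_1,\mathbf{v}_1)\to\cdots\to(c_n,\mathbf{v}_n)$ in $\mathcal{C}$ if and only if there exists a run $(c_0,\mathbf{v}_0^\alpha)\to(c_1,\mathbf{v}_1^\alpha)\to\cdots\to(c_n,\mathbf{v}_n^\alpha)$ in $\mathcal{C}_\alpha$ such that $\alpha(c_i,\mathbf{v}_i)=(c_i,\mathbf{v}_i^\alpha)$ for each $i$. That is: for every run of $\mathcal{C}$, its pointwise image under $\alpha$ is a run of $\mathcal{C}_\alpha$; and for every run $(c_0,\mathbf{v}_0^\alpha)\to\cdots\to(c_n,\mathbf{v}_n^\alpha)$ of $\mathcal{C}_\alpha$ there exist $\mathbf{v}_0,\dots,\mathbf{v}_n\in\mathbb{N}^Q$ with $\alpha(c_i,\mathbf{v}_i)=(c_i,\mathbf{v}_i^\alpha)$ for all $i$ such that $(c_0,\mathbf{v}_0)\to\cdots\to(c_n,\mathbf{v}_n)$ is a run of $\mathcal{C}$.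
   Context: For $\mathbf{v}\in\mathbb{N}^Q$ let $|\mathbf{v}|=\sum_{q\in Q}\mathbf{v}(q)$. A counter system (CS) is a triple $\mathcal{C}=(C,Q,\mathcal{T})$ with $C$ a finite set (controller states), $Q$ a finite set (user states), and a step relation $\mathcal{T}\subseteq(C\times\mathbb{N}^Q)\times(C\times\mathbb{N}^Q)$ that is size-preserving: $((c,\mathbf{v}),(c',\mathbf{v}'))\in\mathcal{T}$ implies $|\mathbf{v}|=|\mathbf{v}'|$. Configurations are the elements of $C\times\mathbb{N}^Q$; one writes $(c,\mathbf{v})\to(c',\mathbf{v}')$ for $((c,\mathbf{v}),(c',\mathbf{v}'))\in\mathcal{T}$. With fixed initial states $c_0\in C$, $Q_0\subseteq Q$, an initial configuration is any $(c_0,\mathbf{v}_0)$ with $\mathbf{v}_0(q)=0$ for all $q\notin Q_0$. A run is a finite sequence of steps starting in an initial configuration. Order: $(c,\mathbf{v})\preceq_0(d,\mathbf{w})$ iff $c=d$ and, for all $q\in Q$, $\mathbf{v}(q)\le\mathbf{w}(q)$ and $(\mathbf{v}(q)=0\Leftrightarrow\mathbf{w}(q)=0)$. $\mathcal{C}$ is forward $\preceq_0$-compatible if whenever $(c,\mathbf{v})\to(c',\mathbf{v}')$ and $(c,\mathbf{v})\preceq_0(d,\mathbf{w})$, there is a step $(d,\mathbf{w})\to(d',\mathbf{w}')$ with $(c',\mathbf{v}')\preceq_0(d',\mathbf{w}')$. It is backward $\preceq_0$-compatible if whenever $(c,\mathbf{v})\to(c',\mathbf{v}')$ and $(c',\mathbf{v}')\preceq_0(d',\mathbf{w}')$,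 there is a step $(d,\mathbf{w})\to(d',\mathbf{w}')$ with $(c,\mathbf{v})\preceq_0(d,\mathbf{w})$. Fully $\preceq_0$-compatible means both. Abstraction: $\alpha:C\times\mathbb{N}^Q\to C\times\{0,1\}^Q$, $\alpha(c,\mathbf{v})=(c,\mathbf{v}^\alpha)$ with $\mathbf{v}^\alpha(q)=1$ if $\mathbf{v}(q)\ge1$ and $\mathbf{v}^\alpha(q)=0$ if $\mathbf{v}(q)=0$. The $01$-counter system $\mathcal{C}_\alpha$ has configurations $C\times\{0,1\}^Q$ and a step $(c,\mathbf{x})\to(c',\mathbf{x}')$ iff there is a step $(c,\mathbf{v})\to(c',\mathbf{v}')$ in $\mathcal{T}$ with $\alpha(c,\mathbf{v})=(c,\mathbf{x})$ and $\alpha(c',\mathbf{v}')=(c',\mathbf{x}')$. Its initial configurations are the $(c_0,\mathbf{x})$ with $\mathbf{x}(q)=0$ for all $q\notin Q_0$, and its runs are finite sequences of its steps starting in an initial configuration. *)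

(* Defs.v *)
From mathcomp Require Import all_boot.

Set Implicit Arguments.
Unset Strict Implicit.
Unset Printing Implicit Defensive.

Definition config (C Q : finType) : Type := (C * {ffun Q -> nat})%type.

(* {0,1} is rendered as bool: 0 is false and 1 is true. *)
Definition config01 (C Q : finType) : Type := (C * {ffun Q -> bool})%type.

Definition vsize (Q : finType) (v : {ffun Q -> nat}) : nat := \sum_(q : Q) v q.

Record counter_system (C Q : finType) : Type := CounterSystem {
  step : config C Q -> config C Q -> Prop;
  step_size : forall s s' : config C Q, step s s' -> vsize s.2 = vsize s'.2
}.

(* r lists the n.+1 states of a run with n steps; for i : 'I_n, the indices
   widen_ord (leqnSn n) i and lift ord0 i of 'I_n.+1 have values i and i.+1. *)
Definition is_run (S : Type) (init : S -> Prop) (tr : S -> S -> Prop)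
    (n : nat) (r : 'I_n.+1 -> S) : Prop :=
  init (r ord0) /\
  forall i : 'I_n, tr (r (widen_ord (leqnSn n) i)) (r (lift ord0 i)).

Section CounterSystem.

Variables C Q : finType.

Definition initial (c0 : C) (Q0 : {set Q}) (s : config C Q) : Prop :=
  s.1 = c0 /\ forall q : Q, q \notin Q0 -> s.2 q = 0.

Definition initial01 (c0 : C) (Q0 : {set Q}) (x : config01 C Q) : Prop :=
  x.1 = c0 /\ forall q : Q, q \notin Q0 -> x.2 q = false.

Definition le0 (s t : config C Q) : Prop :=
  s.1 = t.1 /\
  forall q : Q, s.2 q <= t.2 q /\ (s.2 q = 0 <-> t.2 q = 0).

Definition alpha (s : config C Q) : config01 C Q :=
  (s.1, [ffun q => 1 <= s.2 q]).

Variable CS : counter_system C Q.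

Definition forward_compatible : Prop :=
  forall s s' t : config C Q, step CS s s' -> le0 s t ->
    exists t' : config C Q, step CS t t' /\ le0 s' t'.

Definition backward_compatible : Prop :=
  forall s s' t' : config C Q, step CS s s' -> le0 s' t' ->
    exists t : config C Q, step CS t t' /\ le0 s t.

Definition fully_compatible : Prop :=
  forward_compatible /\ backward_compatible.

Definition step01 (x x' : config01 C Q) : Prop :=
  exists s s' : config C Q, [/\ step CS s s', alpha s = x & alpha s' = x'].

Definition cs_run (c0 : C) (Q0 : {set Q}) (n : nat)
    (r : 'I_n.+1 -> config C Q) : Prop :=
  is_run (initial c0 Q0) (step CS) r.

Definition cs_run01 (c0 : C) (Q0 : {set Q}) (n : nat)
    (r : 'I_n.+1 -> config01 C Q) : Prop :=
  is_run (initial01 c0 Q0) step01 r.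

End CounterSystem.

(* Main.v *)
(** A run of the 01-system is lifted backwards from its last state.  If a tail
    has been lifted to a run starting in [u] and the preceding abstract step is
    witnessed by [s -> s'], then [s'] and [u] have the same abstraction, so
    their pointwise maximum [t] dominates both for the order.  Backward
    compatibility moves the step [s -> s'] up to one ending in [t], and forward
    compatibility moves the lifted tail up to a run starting in [t]; neither
    changes abstractions. *)
Require Import Defs.
From mathcomp Require Import all_boot.

Set Implicit Arguments.
Unset Strict Implicit.

Section Abstraction.

Variables C Q : finType.
Implicit Types s t : config C Q.

Lemma le0_alpha s t : le0 s t -> alpha s = alpha t.
Proof.
case: s t => [c v] [d w] [/= -> h]; congr pair; apply/ffunP => q /=.
rewrite !ffunE /= !lt0n; have [_ [h1 h2]] := h q.
by congr negb; apply/eqP/eqP.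
Qed.

(** Initiality fixes the controller state and forces some entries to vanish; [alpha] retains both
    data, so paths can be lifted without tracking initiality. *)
Lemma initial_alpha (c0 : C) (Q0 : {set Q}) s :
  initial01 c0 Q0 (alpha s) <-> initial c0 Q0 s.
Proof.
split=> -[hc h]; split=> // q /h; first by rewrite ffunE; case: (s.2 q).
by rewrite ffunE => ->.
Qed.

Lemma alpha_surj (x : config01 C Q) : exists s, alpha s = x.
Proof.
exists (x.1, [ffun q => nat_of_bool (x.2 q)]).
by case: x => c v; congr pair; apply/ffunP => q; rewrite !ffunE /=; case: (v q).
Qed.

Definition join s t : config C Q := (s.1, [ffun q => maxn (s.2 q) (t.2 q)]).

(** Equal abstractions make the entries at [q] vanish together, so their maximum vanishes exactly
    when each does. *)
Lemma le0_joinl s t : alpha s = alpha t -> le0 s (join s t).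
Proof.
move=> [_ /ffunP e]; split=> //= q; rewrite ffunE leq_maxl; split=> //.
by move: (e q); rewrite !ffunE; case: (s.2 q) (t.2 q) => [|m] [|k] //; rewrite maxnSS.
Qed.

Lemma joinC s t : alpha s = alpha t -> join s t = join t s.
Proof.
by move=> [e _]; rewrite /join e; congr pair; apply/ffunP => q; rewrite !ffunE maxnC.
Qed.

Lemma le0_joinr s t : alpha s = alpha t -> le0 t (join s t).
Proof. by move=> e; rewrite joinC //; apply: le0_joinl. Qed.

End Abstraction.

Section Lifting.

Variables (C Q : finType) (CS : counter_system C Q).

(** Induction with [f] and [t] general: the target of the moved first step is the new start for the
    shifted path. *)
Lemma forward_compatible_path n (f : nat -> config C Q) (t : config C Q) :
  forward_compatible CS ->
  (forall i, i < n -> step CS (f i) (f i.+1)) -> le0 (f 0) t ->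
  exists g : nat -> config C Q,
    [/\ g 0 = t, forall i, i < n -> step CS (g i) (g i.+1)
      & forall i, i <= n -> le0 (f i) (g i)].
Proof.
move=> fwd; elim: n f t => [|n IH] f t hf ft.
  by exists (fun=> t); split=> // -[].
have [t' [tt' ft']] := fwd _ _ _ (hf 0 isT) ft.
have [g [g0 hg fg]] := IH (fun i => f i.+1) t' (fun i => hf i.+1) ft'.
exists (fun i => if i is j.+1 then g j else t); split=> //.
  by case=> [|i] lt_in; [rewrite g0 | apply: hg].
by case=> [|i] le_in //; apply: fg.
Qed.

Lemma step01_path_lift n (x : nat -> config01 C Q) :
  fully_compatible CS -> (forall i, i < n -> step01 CS (x i) (x i.+1)) ->
  exists f : nat -> config C Q,
    (forall i, i <= n -> alpha (f i) = x i) /\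
    (forall i, i < n -> step CS (f i) (f i.+1)).
Proof.
move=> [fwd bwd]; elim: n x => [|n IH] x hx.
  have [s sx] := alpha_surj (x 0).
  by exists (fun=> s); split=> // -[].
have [f [fx hf]] := IH (fun i => x i.+1) (fun i => hx i.+1).
have [s [s' [ss' sx s'x]]] := hx 0 isT.
have e : alpha s' = alpha (f 0) by rewrite s'x fx.
(* The step out of [t] ends in [join s' (f 0)], which is also where the raised tail [g] starts, so
   the two can be glued. *)
have [t [tt' st]] := bwd _ _ _ ss' (le0_joinl e).
have [g [g0 hg fg]] := forward_compatible_path fwd hf (le0_joinr e).
exists (fun i => if i is j.+1 then g j else t); split.
  case=> [|i] le_in; first by rewrite -(le0_alpha st).
  by rewrite -(le0_alpha (fg i le_in)) fx.
by case=> [|i] lt_in; [rewrite g0 | apply: hg].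
Qed.

End Lifting.

Theorem lemma2 (C Q : finType) (CS : counter_system C Q)
    (c0 : C) (Q0 : {set Q}) (hCS : fully_compatible CS) :
  (forall (n : nat) (r : 'I_n.+1 -> config C Q),
     cs_run CS c0 Q0 r -> cs_run01 CS c0 Q0 (fun i => alpha (r i)))
  /\
  (forall (n : nat) (x : 'I_n.+1 -> config01 C Q),
     cs_run01 CS c0 Q0 x ->
     exists r : 'I_n.+1 -> config C Q,
       (forall i : 'I_n.+1, alpha (r i) = x i) /\ cs_run CS c0 Q0 r).
Proof.
split=> n.
  move=> r [r0 hr]; split; first exact/initial_alpha.
  by move=> i; exists (r (widen_ord (leqnSn n) i)), (r (lift ord0 i)).
move=> x [x0 hx].
(* [inord] extends [x] to all natural indices; its default value above [n] is never reached, since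
   [i < n]. *)
have hx' i : i < n -> step01 CS (x (inord i)) (x (inord i.+1)).
  move=> lt_in; have := hx (Ordinal lt_in).
  by rewrite -[widen_ord _ _]inord_val -[lift _ _]inord_val.
have [f [fx hf]] := step01_path_lift (x := fun i => x (inord i)) hCS hx'.
have fx' (i : 'I_n.+1) : alpha (f i) = x i by rewrite fx ?inord_val // -ltnS.
exists (fun i => f i); split=> //; split.
  by apply/initial_alpha; rewrite fx'.
by move=> i; exact: (hf i (ltn_ord i)).
Qed.
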